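(* Let $X$ and $Y$ be connected complex manifolds and let $\pi:X\to Y$ be a finite unramified covering. Then the Kobayashi pseudodistance $d_X$ vanishes identically if and only if the Kobayashi pseudodistance $d_Y$ vanishes identically.
   Context: A finite unramified covering is a holomorphic topological covering map (locally biholomorphic) with finite fibers. Let $\Delta=\{z\in\mathbb{C}:|z|<1\}$ be the unit disc and let $d_\Delta$ be the Poincaré distance on $\Delta$. For a connected complex manifold $Z$ and $p,q\in Z$, the Kobayashi pseudodistance $d_Z(p,q)$ is the infimum of $\sum_{i=1}^k d_\Delta(a_i,b_i)$ over all chains of discs from $p$ to $q$, i.e. over all $k\ge 1$, points $p=p_0,p_1,\dots,p_k=q$ of $Z$, points $a_i,b_i\in\Delta$ and holomorphic maps $f_i:\Delta\to Z$ with $f_i(a_i)=p_{i-1}$ and $f_i(b_i)=p_i$. It vanishes identically if $d_Z(p,q)=0$ for all $p,q\in Z$. *)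

(* Defs.v *)
From HB Require Import structures.
From mathcomp Require Import all_boot all_order all_algebra.
From mathcomp Require Import all_classical all_reals all_analysis.
From mathcomp Require Import complex.
Set Implicit Arguments.
Unset Strict Implicit.
Unset Printing Implicit Defensive.
Import Order.TTheory GRing.Theory Num.Theory.
Import numFieldNormedType.Exports.
Local Open Scope classical_set_scope.
Local Open Scope ring_scope.
Local Open Scope complex_scope.

(* The library equips an abstract numFieldType, but not the concrete R[i], with
   its structure of normed space over itself. *)
HB.instance Definition _ (R : realType) := NormedModule.copy R[i] R[i]^o.

(* [f] and [g] are total functions; only their restrictions to [A] and [B]
   matter. *)
Definition homeomorphic_via (S T : topologicalType) (A : set S) (B : set T)
    (f : S -> T) (g : T -> S) : Prop :=
  [/\ (forall x, A x -> B (f x) /\ g (f x) = x),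
      (forall y, B y -> A (g y) /\ f (g y) = y),
      {within A, continuous f} & {within B, continuous g}].

(* [chart_coord] is a homeomorphism from the open set [chart_dom] of [M] onto
   the open set [chart_img] of C^n, with inverse [chart_param]; both maps take
   junk values outside these sets. *)
Record chart (R : realType) (n : nat) (M : topologicalType) := Chart {
  chart_dom : set M ;
  chart_img : set 'rV[R[i]]_n ;
  chart_coord : M -> 'rV[R[i]]_n ;
  chart_param : 'rV[R[i]]_n -> M ;
  chart_dom_open : open chart_dom ;
  chart_img_open : open chart_img ;
  chart_homeo :
    homeomorphic_via chart_dom chart_img chart_coord chart_param
}.

(* [differentiable] is Frechet differentiability over the scalar field R[i],
   that is, complex differentiability; the transition maps are holomorphic
   because they are so at every point of their open domains. *)
HB.mixin Record Topological_isComplexManifold (R : realType) (n : nat) M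
    of Topological M := {
  manifold_hausdorff : hausdorff_space M ;
  manifold_second_countable : @second_countable M ;
  atlas : set (chart R n M) ;
  atlas_cover : forall x : M, exists2 phi, atlas phi & chart_dom phi x ;
  atlas_holomorphic : forall phi psi, atlas phi -> atlas psi ->
    forall x : M, chart_dom phi x -> chart_dom psi x ->
    differentiable (chart_coord psi \o chart_param phi) (chart_coord phi x)
}.

#[short(type="complexManifoldType")]
HB.structure Definition ComplexManifold (R : realType) (n : nat) :=
  { M of Topological M & Topological_isComplexManifold R n M }.

Arguments atlas {R n} s : rename.

(* The empty space is not considered connected; note that
   [connected set0] holds in the library. *)
Definition connected_manifold (R : realType) (n : nat)
    (M : complexManifoldType R n) : Prop :=
  [set: M] !=set0 /\ connected [set: M].

Definition holomorphic_on (R : realType) (m n : nat)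
    (X : complexManifoldType R m) (Y : complexManifoldType R n)
    (D : set X) (f : X -> Y) : Prop :=
  forall x, D x -> {for x, continuous f} /\
    forall phi psi, atlas X phi -> atlas Y psi ->
      chart_dom phi x -> chart_dom psi (f x) ->
      differentiable (chart_coord psi \o f \o chart_param phi)
                     (chart_coord phi x).

(* This is meaningful for open sets [U] and [V]. *)
Definition biholomorphic_via (R : realType) (m n : nat)
    (X : complexManifoldType R m) (Y : complexManifoldType R n)
    (U : set X) (V : set Y) (f : X -> Y) (g : Y -> X) : Prop :=
  [/\ homeomorphic_via U V f g, holomorphic_on U f & holomorphic_on V g].

Definition locally_biholomorphic (R : realType) (m n : nat)
    (X : complexManifoldType R m) (Y : complexManifoldType R n)
    (f : X -> Y) : Prop :=
  forall x, exists (U : set X) (V : set Y) (g : Y -> X),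
    [/\ open U, open V, U x & biholomorphic_via U V f g].

Definition evenly_covered (S T : topologicalType) (f : S -> T) (V : set T)
    : Prop :=
  exists sheets : set (set S),
    [/\ trivIset sheets id,
        \bigcup_(U in sheets) U = f @^-1` V
      & forall U, sheets U ->
          open U /\ exists g, homeomorphic_via U V f g].

Definition topological_covering (S T : topologicalType) (f : S -> T) : Prop :=
  [/\ continuous f, range f = [set: T]
    & forall y, exists V, [/\ open V, V y & evenly_covered f V]].

Definition finite_unramified_covering (R : realType) (m n : nat)
    (X : complexManifoldType R m) (Y : complexManifoldType R n)
    (f : X -> Y) : Prop :=
  [/\ holomorphic_on [set: X] f, topological_covering f,
      locally_biholomorphic f & forall y, finite_set (f @^-1` [set y])].

Definition unit_disc (R : realType) : set R[i] :=
  [set z | Normc.normc z < 1].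

(* Normalized to have constant curvature -1. *)
Definition poincare_dist (R : realType) (a b : R[i]) : R :=
  let rho := Normc.normc ((a - b) / (1 - a * b^*)) in
  ln ((1 + rho) / (1 - rho)).

(* Holomorphic maps from the disc, as total functions on C of which only the
   restriction to the disc matters. *)
Definition holomorphic_disc (R : realType) (n : nat)
    (Z : complexManifoldType R n) (f : R[i] -> Z) : Prop :=
  forall z : R[i], unit_disc z -> {for z, continuous f} /\
    forall phi, atlas Z phi -> chart_dom phi (f z) ->
      differentiable (chart_coord phi \o f) z.

(* Only the values x 0, ..., x k and a i, b i, f i for i < k matter. *)
Definition disc_chain (R : realType) (n : nat) (Z : complexManifoldType R n)
    (p q : Z) (k : nat) (x : nat -> Z) (a b : nat -> R[i])
    (f : nat -> R[i] -> Z) : Prop :=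
  [/\ (0 < k)%N, x 0%N = p, x k = q
    & forall i, (i < k)%N ->
        [/\ unit_disc (a i), unit_disc (b i), holomorphic_disc (f i),
            f i (a i) = x i & f i (b i) = x i.+1]].

(* The infimum is taken in the extended reals: it is +oo if there is no
   chain, instead of the value 0 given by convention to inf set0 in R. *)
Definition kobayashi (R : realType) (n : nat) (Z : complexManifoldType R n)
    (p q : Z) : \bar R :=
  ereal_inf [set d : \bar R | exists k x a b f,
    disc_chain p q k x a b f /\
    d = (\sum_(i < k) poincare_dist (a i) (b i))%:E].

Definition kobayashi_vanishes (R : realType) (n : nat)
    (Z : complexManifoldType R n) : Prop :=
  forall p q : Z, kobayashi p q = 0%E.

(* Main.v *)
Require Import Defs.
From mathcomp Require Import all_boot all_order all_algebra.
From mathcomp Require Import all_classical all_reals all_analysis.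
From mathcomp Require Import complex.
From mathcomp Require Import ring lra.
Set Implicit Arguments.
Unset Strict Implicit.
Unset Printing Implicit Defensive.
Import Order.TTheory GRing.Theory Num.Theory.
Import numFieldNormedType.Exports.
Local Open Scope classical_set_scope.
Local Open Scope ring_scope.
Local Open Scope complex_scope.

(** Composing discs with the covering shows that it decreases distances, which
    gives one implication. Conversely, a disc in [Y] lifts to [X] with any
    prescribed starting point, the disc being simply connected, so chains of
    discs lift as well; as fibers are finite, every [x] is at distance 0 from
    some point of every fiber. Hence the classes of the relation [d_X = 0] all
    meet a fixed fiber, and there are finitely many of them. They are closed,
    because [d_X (p, q)] tends to 0 as [q] tends to [p] in a chart, so by
    connectedness of [X] there is only one. *)

(** * Holomorphic discs *)

(** The difference [g - f] vanishes near [x], so its differential there is the zero map. *)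
Lemma near_eq_differentiable (K : numFieldType) (V W : normedModType K)
    (f g : V -> W) (x : V) :
  (\forall y \near x, f y = g y) -> differentiable f x -> differentiable g x.
Proof.
move=> fg df.
have -> : g = f + (g - f) by rewrite addrC subrK.
apply: differentiableD => //.
have h0 : \forall y \near x, (g - f) y = 0.
  by apply: filterS fg => y fgy; rewrite -[LHS]/(g y - f y) fgy subrr.
set h := g - f in h0 *.
have c0 : continuous (\0 : {linear V -> W}) by exact: cst_continuous.
have dh : h \o shift x = cst (h x) + (\0 : {linear V -> W}) +o_ 0 id.
  apply/eqaddoP => e e0; near=> y.
  rewrite -[X in `|X|]/(h (y + x) - (h x + 0)) (nbhs_singleton h0).
  have -> : h (y + x) = 0.
    by near: y; move: h0; rewrite (near_shift 0 x) subr0.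
  by rewrite addr0 subr0 normr0 mulr_ge0// ltW.
apply/diff_locallyP.
by rewrite (diff_unique c0 dh).
Unshelve. all: by end_near. Qed.

Lemma near_eq_continuous (S T : topologicalType) (f g : S -> T) (x : S) :
  (\forall y \near x, f y = g y) -> {for x, continuous f} ->
  {for x, continuous g}.
Proof.
move=> fg cf; rewrite /prop_for /continuous_at -(nbhs_singleton fg).
exact: cvg_trans (near_eq_cvg fg) cf.
Qed.

Section HomeomorphicVia.
Variables (S T : topologicalType) (A : set S) (B : set T).
Variables (f : S -> T) (g : T -> S).
Hypothesis fg : homeomorphic_via A B f g.

Lemma homeomorphic_via_sym : homeomorphic_via B A g f.
Proof. by case: fg. Qed.

Lemma homeomorphic_via_continuous x : open A -> A x -> continuous_at x f.
Proof.
move=> oA Ax; case: fg => _ _ + _; rewrite continuous_open_subspace//.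
by apply; rewrite inE.
Qed.

End HomeomorphicVia.

Section Holomorphic.
Variable R : realType.

(** The pointwise condition inside [holomorphic_disc], isolated so that a disc can be treated
    locally. *)
Definition holomorphic_at n (Z : complexManifoldType R n) (f : R[i] -> Z)
    (z : R[i]) : Prop :=
  {for z, continuous f} /\ forall phi, atlas Z phi -> chart_dom phi (f z) ->
    differentiable (chart_coord phi \o f) z.

Lemma near_eq_holomorphic_at n (Z : complexManifoldType R n)
    (f g : R[i] -> Z) (z : R[i]) :
  (\forall w \near z, f w = g w) -> holomorphic_at f z -> holomorphic_at g z.
Proof.
move=> fg [cf df]; split; first exact: near_eq_continuous fg cf.
move=> phi aphi; rewrite -(nbhs_singleton fg) => /(df _ aphi).
by apply: near_eq_differentiable; apply: filterS fg => w /= ->.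
Qed.

(** A chart [phi] around [f z] is inserted between [h] and [f]. By continuity [f] stays in its
    domain near [z], where [chart_param phi] undoes [chart_coord phi]. *)
Lemma holomorphic_at_comp m n (X : complexManifoldType R m)
    (Y : complexManifoldType R n) (D : set X) (h : X -> Y) (f : R[i] -> X)
    (z : R[i]) :
  holomorphic_on D h -> D (f z) -> holomorphic_at f z ->
  holomorphic_at (h \o f) z.
Proof.
move=> hh Dfz [cf df]; have [ch dh] := hh _ Dfz.
split; first exact: continuous_comp.
move=> psi apsi psiz; have [phi aphi phiz] := atlas_cover (f z).
have := differentiable_comp (df _ aphi phiz) (dh _ _ aphi apsi phiz psiz).
apply: near_eq_differentiable; near=> w.
have [homeo _ _ _] := chart_homeo phi.
suff /homeo[_ /= ->] : chart_dom phi (f w) by [].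
by near: w; apply: cf; apply: open_nbhs_nbhs; split=> //; exact: chart_dom_open.
Unshelve. all: by end_near. Qed.

(** Read in another chart [psi], the map is a transition map of the atlas composed with [f]. *)
Lemma holomorphic_at_chart n (Z : complexManifoldType R n) phi
    (f : R[i] -> 'rV[R[i]]_n) (z : R[i]) :
  atlas Z phi -> chart_img phi (f z) -> differentiable f z ->
  holomorphic_at (chart_param phi \o f) z.
Proof.
move=> aphi phiz df; have [hom1 hom2 _ _] := chart_homeo phi.
have [domz fz] := hom2 _ phiz.
split.
  apply: continuous_comp; first exact: differentiable_continuous.
  exact (homeomorphic_via_continuous (homeomorphic_via_sym (chart_homeo phi))
    (@chart_img_open _ _ _ phi) phiz).
move=> psi apsi psiz.
have := atlas_holomorphic phi psi aphi apsi _ domz psiz.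
by rewrite fz => /(differentiable_comp df).
Qed.

Lemma holomorphic_at_cst n (Z : complexManifoldType R n) (p : Z) (z : R[i]) :
  holomorphic_at (cst p) z.
Proof.
split; first exact: cst_continuous.
move=> phi _ _.
by rewrite -[_ \o _]/(cst (chart_coord phi p)); exact: differentiable_cst.
Qed.

End Holomorphic.

(** * Chains of discs *)

Section Chains.
Variable R : realType.

Lemma normr_normc (z : R[i]) : `|z| = (Normc.normc z)%:C.
Proof. by []. Qed.

Lemma unit_discE (z : R[i]) : unit_disc z = (`|z| < 1).
Proof. by rewrite normr_normc /unit_disc /= ltcE eqxx. Qed.

Lemma normc_conj (z : R[i]) : Normc.normc (z^*) = Normc.normc z.
Proof. by apply: complexI; exact: normcJ. Qed.

(* This holds even outside the disc, where [ln] takes the value 0 at nonpositive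
   arguments. *)
Lemma poincare_dist_ge0 (a b : R[i]) : 0 <= poincare_dist a b.
Proof.
rewrite /poincare_dist; set r := Normc.normc _.
have r0 : 0 <= r by rewrite -ler0c -normr_normc.
have [r1|r1] := ltP r 1; last first.
  by rewrite ln0// mulr_ge0_le0 ?addr_ge0// invr_le0 subr_le0.
by rewrite ln_ge0// ler_pdivlMr ?subr_gt0// mul1r lerD2l; lra.
Qed.

(** Exchanging the points negates the numerator and conjugates the denominator, which preserves the
    modulus. *)
Lemma poincare_dist_sym (a b : R[i]) : poincare_dist a b = poincare_dist b a.
Proof.
rewrite /poincare_dist !Normc.normcM !Normc.normcV -opprB.
suff -> : Normc.normc (1 - a * b^*) = Normc.normc (1 - b * a^*).
  by rewrite (_ : Normc.normc (- (b - a)) = Normc.normc (b - a))//;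
    exact: normcN.
rewrite -normc_conj rmorphB rmorph1 rmorphM mulrC.
by congr (Normc.normc (_ - _ * _)); exact: conjCK.
Qed.

Lemma poincare_distxx (a : R[i]) : poincare_dist a a = 0.
Proof.
by rewrite /poincare_dist subrr mul0r Normc.normc0 addr0 subr0 divr1 ln1.
Qed.

Section Linked.
Variables (n : nat) (Z : complexManifoldType R n).

(* [linked p q L]: some chain of discs from [p] to [q] has length [L]. Unlike in
   [disc_chain], the empty chain is allowed. *)
Inductive linked (p : Z) : Z -> R -> Prop :=
| linked_nil : linked p p 0
| linked_step a b f L : unit_disc a -> unit_disc b -> holomorphic_disc f ->
    linked p (f a) L -> linked p (f b) (L + poincare_dist a b).

Lemma linked_trans p q r L L' :
  linked p q L -> linked q r L' -> linked p r (L + L').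
Proof.
move=> pq; elim=> [|a b f L1 ua ub hf _ IH]; first by rewrite addr0.
by rewrite addrA; exact: linked_step.
Qed.

Lemma linked_sym p q L : linked p q L -> linked q p L.
Proof.
elim=> [|a b f {}L ua ub hf _ IH]; first exact: linked_nil.
rewrite addrC; apply: linked_trans IH.
by rewrite poincare_dist_sym -[X in linked _ _ X]add0r;
  apply: linked_step => //; exact: linked_nil.
Qed.

Lemma linked_ge0 p q L : linked p q L -> 0 <= L.
Proof.
by elim=> // a b f {}L _ _ _ _ IH; rewrite addr_ge0// poincare_dist_ge0.
Qed.

Lemma disc_chain_linked p q k x a b f :
  disc_chain (Z := Z) p q k x a b f ->
  linked p q (\sum_(i < k) poincare_dist (a i) (b i)).
Proof.
case=> _ <- <-; elim: k => [|k IH] H; first by rewrite big_ord0;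
  exact: linked_nil.
rewrite big_ord_recr /=; have [ua ub hf fa <-] := H _ (ltnSn k).
by apply: linked_step => //; rewrite fa; apply: IH => i ik; apply: H;
  exact: ltnW.
Qed.

Lemma linked_disc_chain p q L : linked p q L -> exists k x a b f,
  disc_chain (Z := Z) p q k x a b f /\
  L = \sum_(i < k) poincare_dist (a i) (b i).
Proof.
elim=> [|a b f {}L ua ub hf _ [k [x [a' [b' [f' [[k0 x0 xk H] ->]]]]]]].
  (* [disc_chain] asks for at least one disc, so the empty chain becomes a constant disc with equal
     marked points. *)
  exists 1%N, (fun=> p), (fun=> 0), (fun=> 0), (fun=> cst p).
  rewrite big_ord1 poincare_distxx; split=> //; split=> // i _.
  have u0 : unit_disc (0 : R[i]) by rewrite unit_discE normr0 ltr01.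
  by split=> // z _; exact: holomorphic_at_cst.
(* The old chain has points up to index [k] included but discs only below [k], whence the two
   cut-offs [k.+1] and [k]. *)
pose upd T (u : nat -> T) (v : T) (m : nat) i := if (i < m)%N then u i else v.
exists k.+1, (upd _ x (f b) k.+1), (upd _ a' a k), (upd _ b' b k),
  (upd _ f' f k).
split; last first.
  rewrite big_ord_recr /= /upd ltnn; congr (_ + _).
  by apply: eq_bigr => i _; rewrite ltn_ord.
split=> //; rewrite /upd ?ltnn// => i.
rewrite [in X in X -> _]ltnS leq_eqVlt => /predU1P[->|ik].
  by rewrite !ltnn leqnn xk.
by rewrite ik !ltnS ik (ltnW ik); exact: H.
Qed.

(** Lengths are nonnegative, so the infimum is 0 exactly when there are arbitrarily short chains;
    from here on the extended reals are avoided. *)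
Lemma kobayashi_eq0P (p q : Z) :
  kobayashi p q = 0%E <-> forall e, 0 < e -> exists2 L, linked p q L & L < e.
Proof.
split=> [pq0 e e0|H].
  have : (kobayashi p q < e%:E)%E by rewrite pq0 lte_fin.
  move=> /ereal_inf_ltP[d [k [x [a [b [f [cf ->]]]]]]]; rewrite lte_fin => Le.
  by eexists; first exact: disc_chain_linked cf.
apply/eqP; rewrite eq_le; apply/andP; split.
  apply/lee_addgt0Pr => e e0; rewrite add0e.
  have [L pqL Le] := H e e0; apply: ge_ereal_inf; exists L%:E;
    last by rewrite lee_fin ltW.
  have [k [x [a [b [f [cf ->]]]]]] := linked_disc_chain pqL.
  by exists k, x, a, b, f.
apply/ereal_infP => d [k [x [a [b [f [cf ->]]]]]].
by rewrite lee_fin; apply: linked_ge0 (disc_chain_linked cf).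
Qed.

Lemma kobayashi_eq0_sym (p q : Z) : kobayashi p q = 0%E -> kobayashi q p = 0%E.
Proof.
move=> /kobayashi_eq0P H; apply/kobayashi_eq0P => e /H[L pq Le].
by exists L => //; exact: linked_sym.
Qed.

Lemma kobayashi_eq0_trans (p q r : Z) :
  kobayashi p q = 0%E -> kobayashi q r = 0%E -> kobayashi p r = 0%E.
Proof.
move=> /kobayashi_eq0P H1 /kobayashi_eq0P H2; apply/kobayashi_eq0P => e e0.
have e20 : 0 < e / 2 by rewrite divr_gt0.
have [L pq Le] := H1 _ e20; have [L' qr Le'] := H2 _ e20.
exists (L + L'); first exact: linked_trans pq qr.
lra.
Qed.

End Linked.

Lemma linked_map m n (X : complexManifoldType R m) (Y : complexManifoldType R n)
    (h : X -> Y) p q L :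
  holomorphic_on [set: X] h -> linked p q L -> linked (h p) (h q) L.
Proof.
move=> hh; elim=> [|a b f {}L ua ub hf _ IH]; first exact: linked_nil.
apply: (@linked_step _ _ _ _ _ (h \o f)) => // z uz.
exact: (holomorphic_at_comp hh I (hf z uz)).
Qed.

End Chains.

(** * Lifting discs through a covering *)

Section Boxes.
Variable R : realType.

(** Compactness of the interval in the form of a continuous induction: the supremum of the [t]
    reached from [a] cannot stop before [b], since the local hypothesis at that supremum would carry
    it further. *)
Lemma cousin (P : R -> R -> Prop) :
  (forall a b c, a <= b -> b <= c -> P a b -> P b c -> P a c) ->
  (forall x, exists2 d, 0 < d &
    forall a b, x - d < a -> a <= b -> b < x + d -> P a b) ->
  forall a b, a <= b -> P a b.
Proof.
move=> Padd Ploc a b ab.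
pose S := [set t | a <= t <= b /\ P a t].
have Sa : S a.
  have [d d0 Pd] := Ploc a; split; first by rewrite lexx.
  by apply: Pd => //; lra.
have Sb : has_sup S by split; [exists a|exists b => t [/andP[]]].
have as_ : a <= sup S by apply: ub_le_sup => //; case: Sb.
have sb : sup S <= b by apply: ge_sup; [exists a|move=> t [/andP[]]].
have [d d0 Pd] := Ploc (sup S).
have [t [/andP[at_ tb] Pat] st] := sup_adherent d0 Sb.
have ts : t <= sup S by apply: ub_le_sup; [case: Sb|split=> //; apply/andP].
have Pa u : t <= u -> u < sup S + d -> P a u.
  by move=> tu ud; apply: (Padd _ t) => //; exact: Pd.
have [bd|bd] := ltP b (sup S + d); first exact: Pa.
suff : sup S + d / 2 <= sup S by lra.
apply: ub_le_sup; first by case: Sb.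
by split; [lra|apply: Pa; lra].
Qed.

(** The one-dimensional statement is used twice: vertically, to get a strip of positive width around
    each [x] (the predicate [Q], glued by taking the smaller width), then horizontally. *)
Lemma cousin2 (P : R -> R -> R -> R -> Prop) :
  (forall a b c u v, a <= b -> b <= c -> u <= v ->
    P a b u v -> P b c u v -> P a c u v) ->
  (forall a b u v w, a <= b -> u <= v -> v <= w ->
    P a b u v -> P a b v w -> P a b u w) ->
  (forall x y, exists2 d, 0 < d & forall a b u v,
    x - d < a -> a <= b -> b < x + d -> y - d < u -> u <= v -> v < y + d ->
    P a b u v) ->
  forall a b u v, a <= b -> u <= v -> P a b u v.
Proof.
move=> Px Py Ploc a b u v ab uv; apply: (@cousin (fun a b => P a b u v)) => //.
  by move=> a' b' c' ? ?; exact: Px.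
move=> x; pose Q u v := exists2 d, 0 < d &
  forall a b, x - d < a -> a <= b -> b < x + d -> P a b u v.
apply: (@cousin Q) => // [u1 u2 u3 u12 u23 [d1 d10 P1] [d2 d20 P2]|y].
  exists (Num.min d1 d2) => [|a1 b1]; first by rewrite lt_min d10.
  have m1 : Num.min d1 d2 <= d1 by rewrite ge_min lexx.
  have m2 : Num.min d1 d2 <= d2 by rewrite ge_min lexx orbT.
  move=> xa ab1 bx; apply: (Py _ _ _ u2) => //.
    by apply: P1 => //; lra.
  by apply: P2 => //; lra.
have [d d0 Pd] := Ploc x y.
by exists d => // u1 v1 ? ? ?; exists d => // a1 b1 ? ? ?; exact: Pd.
Qed.

Lemma Re_continuous : continuous (@complex.Re R : R[i] -> R).
Proof.
move=> z; apply/(cvgrPdist_lt (F := nbhs z)) => e e0.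
have ec0 : 0 < e%:C :> R[i] by rewrite ltcR.
apply: filterS (nbhsx_ballx z _ ec0) => w zw; rewrite -raddfB -ltcR;
  apply: le_lt_trans zw; exact: normc_ge_Re.
Qed.

Lemma Im_continuous : continuous (@complex.Im R : R[i] -> R).
Proof.
move=> z; have -> : @complex.Im R = (fun w : R[i] => complex.Re (- 'i * w)).
  by apply/funext => -[x y] /=; simpc.
apply: continuous_comp; first exact: mulrl_continuous.
exact: Re_continuous.
Qed.

Definition box (a b u v : R) : set R[i] :=
  [set z | a <= complex.Re z <= b /\ u <= complex.Im z <= v].

Lemma box_closed a b u v : closed (box a b u v).
Proof.
have -> : box a b u v =
    (@complex.Re R @^-1` [set x | a <= x] `&` @complex.Re R @^-1` [set x | x
      <= b]) `&`
    (@complex.Im R @^-1` [set x | u <= x] `&` @complex.Im R @^-1` [set x | x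
      <= v]).
  apply/seteqP; split => z /=.
    by move=> [/andP[? ?] /andP[? ?]].
  by move=> [[? ?] [? ?]]; split; apply/andP.
by do 2!apply: closedI; apply: closed_comp; try exact: closed_ge;
  try exact: closed_le;
 move=> ? _; first [exact: Re_continuous|exact: Im_continuous].
Qed.

Lemma box_nbhs a b u v (z : R[i]) :
  a < complex.Re z -> complex.Re z < b -> u < complex.Im z ->
  complex.Im z < v -> nbhs z (box a b u v).
Proof.
move=> az zb uz zv; near=> w; split; apply/andP; split; apply: ltW; near: w.
- exact: cvgr_gt (@Re_continuous z) _ _.
- exact: cvgr_lt (@Re_continuous z) _ _.
- exact: cvgr_gt (@Im_continuous z) _ _.
- exact: cvgr_lt (@Im_continuous z) _ _.
Unshelve. all: by end_near. Qed.

Lemma box_corner a b u v : a <= b -> u <= v -> box a b u v (b +i* u).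
Proof. by move=> ab uv; split => /=; rewrite lexx ?ab ?uv. Qed.

Lemma small_box (x y : R) (N : set R[i]) : nbhs (x +i* y) N ->
  exists2 d, 0 < d & forall a b u v, x - d < a -> b < x + d ->
    y - d < u -> v < y + d -> box a b u v `<=` N.
Proof.
move=> /nbhs_ballP[e e0 eN].
(* A positive element of [R[i]] is real, so the radius [e] can be treated as a real number. *)
have eE : e = (complex.Re e)%:C.
  by case: e e0 {eN} => r s; rewrite /= ltcE /= => /andP[/eqP-> _].
have r0 : 0 < complex.Re e by rewrite -ltcR -eE.
(* Each of the two coordinates contributes less than half of the radius. *)
exists (complex.Re e / 2); first by rewrite divr_gt0.
move=> a b u v xa bx yu vy z [/andP[az zb] /andP[uz zv]]; apply: eN.
rewrite /ball /= eE.
have -> : (x +i* y) - z = (x - complex.Re z)%:C + 'i * (y - complex.Im z)%:C.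
  by case: z {az zb uz zv} => p q; simpc.
apply: (le_lt_trans (ler_normD _ _)).
have normcR (r : R) : `|r%:C| = `|r|%:C :> R[i].
  by rewrite normc_def /= expr0n addr0 sqrtr_sqr.
rewrite normrM normCi mul1r !normcR -rmorphD ltcR.
have /ltrD : `|x - complex.Re z| < complex.Re e / 2 by rewrite ltr_norml; lra.
have H : `|y - complex.Im z| < complex.Re e / 2 by rewrite ltr_norml; lra.
by move=> /(_ _ _ H); rewrite -splitr.
Qed.

Lemma boxUx a b c u v : a <= b -> b <= c ->
  box a c u v = box a b u v `|` box b c u v.
Proof.
move=> ab bc; apply/seteqP; split => z; rewrite /box /=.
  move=> [/andP[az zc] uv]; have [zb|bz] := leP (complex.Re z) b.
    by left; split=> //; apply/andP.
  by right; split=> //; apply/andP; split => //; exact: ltW.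
by move=> [[/andP[az zb] uv]|[/andP[bz zc] uv]]; split=> //; apply/andP;
  split; lra.
Qed.

Lemma boxIx a b c u v : a <= b -> b <= c ->
  box a b u v `&` box b c u v = box b b u v.
Proof.
move=> ab bc; apply/seteqP; split => z; rewrite /box /=.
  by move=> [[/andP[_ zb] uv] [/andP[bz _] _]]; split=> //; apply/andP.
by move=> [/andP[bz zb] uv]; split; split=> //; apply/andP; split=> //; lra.
Qed.

Lemma boxUy a b u v w : u <= v -> v <= w ->
  box a b u w = box a b u v `|` box a b v w.
Proof.
move=> uv vw; apply/seteqP; split => z; rewrite /box /=.
  move=> [ab /andP[uz zw]]; have [zb|bz] := leP (complex.Im z) v.
    by left; split=> //; apply/andP.
  by right; split=> //; apply/andP; split => //; exact: ltW.
by move=> [[ab /andP[az zb]]|[ab /andP[bz zc]]]; split=> //; apply/andP;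
  split; lra.
Qed.

Lemma boxIy a b u v w : u <= v -> v <= w ->
  box a b u v `&` box a b v w = box a b v v.
Proof.
move=> uv vw; apply/seteqP; split => z; rewrite /box /=.
  by move=> [[ab /andP[_ zb]] [_ /andP[bz _]]]; split=> //; apply/andP.
by move=> [ab /andP[bz zb]]; split; split=> //; apply/andP; split=> //; lra.
Qed.

End Boxes.

(** Connectedness of boxes, by subdivision: a property locally constant on [B] is constant on small
    boxes, and adjacent boxes share a point. The set [B] stays fixed while the boxes vary, so that
    the local hypothesis keeps its meaning under subdivision. *)
Lemma box_connected (R : realType) (B : set R[i]) (E : R[i] -> Prop) :
  closed B -> (forall z, B z -> \forall w \near z, B w -> (E w <-> E z)) ->
  forall a b u v, a <= b -> u <= v -> box a b u v `<=` B ->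
  forall z w, box a b u v z -> box a b u v w -> E z -> E w.
Proof.
move=> cB locE a0 b0 u0 v0 ab0 uv0.
pose P a b u v := box a b u v `<=` B -> 
  forall z w, box a b u v z -> box a b u v w -> E z -> E w.
have glue (A A' C : set R[i]) c : A `|` A' = C -> A c -> A' c ->
    (A `<=` B -> forall z w, A z -> A w -> E z -> E w) ->
    (A' `<=` B -> forall z w, A' z -> A' w -> E z -> E w) ->
    C `<=` B -> forall z w, C z -> C w -> E z -> E w.
  move=> <- Ac Ac' EA EA' sub.
  have {}EA := EA (subset_trans (@subsetUl _ _ _) sub).
  have {}EA' := EA' (subset_trans (@subsetUr _ _ _) sub).
  move=> z w [Az|A'z] [Aw|A'w] Ez.
  - exact: EA Az Aw Ez.
  - exact: EA' Ac' A'w (EA _ _ Az Ac Ez).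
  - exact: EA Ac Aw (EA' _ _ A'z Ac' Ez).
  - exact: EA' A'z A'w Ez.
apply: (@cousin2 R P) => //.
- move=> a b c u v ab bc uv; apply: (glue _ _ _ (b +i* u));
  first by rewrite -boxUx.
    exact: box_corner.
  by split => /=; lra.
- move=> a b u v w ab uv vw; apply: (glue _ _ _ (b +i* v));
  first by rewrite -boxUy.
    by split => /=; lra.
  exact: box_corner.
move=> x y; have [Bz|nBz] := pselect (B (x +i* y)).
  have [d d0 H] := small_box (locE _ Bz); exists d => //.
  move=> a b u v xa _ bx yu _ vy sub z w az aw Ez.
  have [Hz Hw] := (H _ _ _ _ xa bx yu vy _ az (sub _ az),
    H _ _ _ _ xa bx yu vy _ aw (sub _ aw)).
  by apply/Hw/Hz.
(* Subdivision also asks about points outside [B]; there, as [B] is closed, small boxes miss [B] and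
   the inclusion in [B] is contradictory. *)
have nB : nbhs (x +i* y) (~` B).
  by apply: open_nbhs_nbhs; split => //; exact: closed_openC.
have [d d0 H] := small_box nB; exists d => // a b u v xa ab bx yu uv vy sub.
have c := box_corner ab uv.
by have [] := H _ _ _ _ xa bx yu vy _ c; exact: sub.
Qed.

(** * Existence and uniqueness of lifts on boxes and on the plane *)

Section Covering.
Variables (X Y : topologicalType) (f : X -> Y).
Hypothesis cov : topological_covering f.

(** The inverse of the sheet through [x] is the section. The same [V] serves all points above it, so
    the size of a liftable box does not depend on the starting point of the lift. *)
Lemma covering_section (y : Y) : exists2 V : set Y, nbhs y V &
  forall x, V (f x) -> exists2 s : Y -> X,
    s (f x) = x & forall y', V y' -> {for y', continuous s} /\ f (s y') = y'.
Proof.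
case: cov => _ _ /(_ y)[V [oV Vy [sheets [_ cover sh]]]].
exists V; first exact: open_nbhs_nbhs.
move=> x Vfx; have : (f @^-1` V) x by [].
rewrite -cover => -[U sU Ux]; have [oU [s hs]] := sh _ sU.
have [h1 h2 _ _] := hs; exists s; first by case: (h1 _ Ux).
move=> y' Vy'; split; last by case: (h2 _ Vy').
exact (homeomorphic_via_continuous (homeomorphic_via_sym hs) oV Vy').
Qed.

(** Two points of a fiber lie in the same sheet, on which [f] is injective, or in disjoint sheets.
    This makes coincidence of two lifts a locally constant property. *)
Lemma covering_agree (x1 x2 : X) : f x1 = f x2 ->
  exists U1 U2, [/\ nbhs x1 U1, nbhs x2 U2 & forall x1' x2',
    U1 x1' -> U2 x2' -> f x1' = f x2' -> (x1' = x2' <-> x1 = x2)].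
Proof.
move=> fx; case: cov => _ _ /(_ (f x1))[V [oV Vx1 [sheets [triv cover sh]]]].
have : (f @^-1` V) x1 by []. rewrite -cover => -[U1 sU1 Ux1].
have : (f @^-1` V) x2 by rewrite /= -fx. rewrite -cover => -[U2 sU2 Ux2].
have [oU1 [s1 [h1 _ _ _]]] := sh _ sU1; have [oU2 _] := sh _ sU2.
exists U1, U2; split; try exact: open_nbhs_nbhs.
have inj x x' : U1 x -> U1 x' -> f x = f x' -> x = x'.
  by move=> /h1[_ {2}<-] /h1[_ {2}<-] ->.
have meet x : U1 x -> U2 x -> U1 = U2.
  by move=> U1x U2x; apply: triv => //; exists x.
move=> x1' x2' Ux1' Ux2' fx'; split=> e.
  by apply: inj => //; rewrite (meet x1') ?e// -e.
by apply: inj => //; rewrite (meet x1) ?e// -e.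
Qed.

Variables (R : realType) (F : R[i] -> Y).
Hypothesis cF : continuous F.

Definition lift_on (B : set R[i]) (g : R[i] -> X) : Prop :=
  {within B, continuous g} /\ forall z, B z -> f (g z) = F z.

(** The base point ranges over all of [B], so that a lift on one piece can be continued into another
    from any common point. *)
Definition liftable (B : set R[i]) : Prop := forall z x, B z -> f x = F z ->
  exists2 g, lift_on B g & g z = x.

Lemma lift_on_subset (A B : set R[i]) g :
  A `<=` B -> lift_on B g -> lift_on A g.
Proof.
move=> AB [cg fg]; split; last by move=> z /AB; exact: fg.
exact: continuous_subspaceW cg.
Qed.

Lemma lift_on_box_unique a b u v g1 g2 : a <= b -> u <= v ->
  lift_on (box a b u v) g1 -> lift_on (box a b u v) g2 ->
  forall z w, box a b u v z -> box a b u v w -> g1 z = g2 z -> g1 w = g2 w.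
Proof.
move=> ab uv [c1 f1] [c2 f2].
apply: (@box_connected R (box a b u v) (fun z => g1 z = g2 z)) => //.
  exact: box_closed.
move=> z Bz; have [|U1 [U2 [nU1 nU2 H]]] := @covering_agree (g1 z) (g2 z).
  by rewrite f1 ?f2.
move/subspace_continuousP: c1 => /(_ z Bz) /(_ _ nU1) n1.
move/subspace_continuousP: c2 => /(_ z Bz) /(_ _ nU2) n2.
near=> w => Bw; apply: H.
- by move: Bw; near: w; exact: n1.
- by move: Bw; near: w; exact: n2.
- by rewrite f1 ?f2.
Unshelve. all: by end_near. Qed.

(** The lift on the first piece is continued into the second one from [c]. Uniqueness on the overlap
    makes the two compatible, and closedness of the pieces makes the glued map continuous. *)
Lemma liftableU (A B : set R[i]) c : closed A -> closed B -> A c -> B c ->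
  (forall g1 g2, lift_on (A `&` B) g1 -> lift_on (A `&` B) g2 ->
    g1 c = g2 c -> forall z, (A `&` B) z -> g1 z = g2 z) ->
  liftable A -> liftable B -> liftable (A `|` B).
Proof.
move=> cA cB Ac Bc uniq lA lB z x ABz fx.
wlog Az : A B cA cB Ac Bc uniq lA lB ABz / A z.
  move=> H; have [Az|Bz] := ABz; first exact: H.
  by rewrite setUC; apply: (H B A) => //; rewrite ?[B `&` A]setIC//; left.
have [g gA gz] := lA _ _ Az fx.
have [h hB hc] := lB c (g c) Bc (gA.2 _ Ac).
have gh : forall w, A w -> B w -> g w = h w.
  move=> w Aw Bw; apply: uniq => //.
  - by apply: lift_on_subset gA => ? [].
  - by apply: lift_on_subset hB => ? [].
pose k w := if pselect (A w) then g w else h w.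
have kA w : A w -> k w = g w by rewrite /k; case: pselect.
have kB w : B w -> k w = h w.
  by rewrite /k; case: pselect => // Aw; exact: gh.
exists k; last by rewrite kA.
split; last first.
  by move=> w [Aw|Bw]; [rewrite kA//; exact: gA.2|rewrite kB//; exact: hB.2].
apply: withinU_continuous => //.
  by apply: subspace_eq_continuous gA.1 => w /set_mem /kA.
by apply: subspace_eq_continuous hB.1 => w /set_mem /kB.
Qed.

(** Adjacent boxes meet in a degenerate box, where lifts are unique, so liftability passes to
    unions. A small box is sent by [F] into an evenly covered set, where a section composed with [F]
    is a lift. *)
Lemma liftable_box a b u v : a <= b -> u <= v -> liftable (box a b u v).
Proof.
apply: (@cousin2 R (fun a b u v => liftable (box a b u v))).
- move=> {}a {}b c {}u {}v ab bc uv; rewrite (boxUx _ _ ab bc).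
  apply: (@liftableU _ _ (b +i* u)); try exact: box_closed.
  + exact: box_corner.
  + by split => /=; lra.
  rewrite boxIx// => g1 g2 l1 l2 e z Bz.
  by apply: (lift_on_box_unique _ _ l1 l2 _ Bz e) => //; exact: box_corner.
- move=> {}a {}b {}u {}v w ab uv vw; rewrite (boxUy _ _ uv vw).
  apply: (@liftableU _ _ (b +i* v)); try exact: box_closed.
  + by split => /=; lra.
  + exact: box_corner.
  rewrite boxIy// => g1 g2 l1 l2 e z Bz.
  by apply: (lift_on_box_unique _ _ l1 l2 _ Bz e) => //; exact: box_corner.
move=> x y; have [V nV sec] := covering_section (F (x +i* y)).
have [d d0 H] := small_box (cF nV); exists d => //.
move=> {}a {}b {}u {}v xa _ bx yu _ vy z p Bz fp.
have BV := H _ _ _ _ xa bx yu vy.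
have [|s sp sV] := sec p; first by rewrite fp; exact: BV Bz.
exists (s \o F); last by rewrite /= -fp.
split; last by move=> w Bw /=; case: (sV _ (BV _ Bw)).
apply: continuous_in_subspaceT => w /set_mem Bw.
by apply: continuous_comp; [exact: cF|case: (sV _ (BV _ Bw))].
Qed.

(** The plane is exhausted by the squares [B N] centered at [z0]; by uniqueness their lifts through
    [x0] extend one another. *)
Lemma plane_lift z0 x0 : f x0 = F z0 ->
  exists g : R[i] -> X, [/\ continuous g, forall z, f (g z) = F z & g z0 = x0].
Proof.
move=> fx0.
pose B (N : nat) := box (complex.Re z0 - N%:R) (complex.Re z0 + N%:R)
                (complex.Im z0 - N%:R) (complex.Im z0 + N%:R).
have N0 (N : nat) : 0 <= N%:R :> R by exact: ler0n.
have Bz0 N : B N z0.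
  by have ? := N0 N; split; apply/andP; split; lra.
have /choice[g gB] N : exists g, lift_on (B N) g /\ g z0 = x0.
  have ? := N0 N.
  have [||g gl gz] := liftable_box _ _ (Bz0 N) fx0; [lra|lra|].
  by exists g.
have BS M N : (M <= N)%N -> B M `<=` B N.
  move=> MN z [/andP[? ?] /andP[? ?]].
  have : M%:R <= N%:R :> R by rewrite ler_nat.
  by move=> ?; split; apply/andP; split; lra.
have coh M N z : (M <= N)%N -> B M z -> g M z = g N z.
  move=> MN Bz; have [[l1 e1] [l2 e2]] := (gB M, gB N).
  have l2' := lift_on_subset (BS _ _ MN) l2.
  apply: (lift_on_box_unique _ _ l1 l2' (Bz0 M) Bz); last by rewrite e1 e2.
    by have ? := N0 M; lra.
  by have ? := N0 M; lra.
have BN (z : R[i]) : exists N, nbhs z (B N).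
  pose r := `|complex.Re (z - z0)| + `|complex.Im (z - z0)|.
  exists (Num.bound r).
  have : r < (Num.bound r)%:R.
    by apply: archi_boundP; rewrite addr_ge0.
  have : `|complex.Re (z - z0)| <= r by rewrite lerDl.
  have : `|complex.Im (z - z0)| <= r by rewrite lerDr.
  move: (r) (Num.bound r) => s N; rewrite !raddfB !ler_norml.
  by move=> /andP[? ?] /andP[? ?] ?; apply: box_nbhs; lra.
have [nu nuP] := choice BN.
(* The square [B (nu z)] is a neighborhood of [z], so [G] coincides near [z] with one continuous
   lift. *)
pose G z := g (nu z) z.
have GE N z : B N z -> G z = g N z.
  move=> Bz; rewrite /G; have Bz' := nbhs_singleton (nuP z).
  by have [?|/ltnW ?] := leqP (nu z) N; [|symmetry]; exact: coh.
exists G; split.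
- move=> z; apply: (@near_eq_continuous _ _ (g (nu z))).
    by apply: filterS (nuP z) => w Bw; rewrite (GE _ _ Bw).
  have [[cg _] _] := gB (nu z).
  move/subspace_continuousP: cg => /(_ z (nbhs_singleton (nuP z))) cg U /cg nU.
  have {}nU : \forall w \near z, B (nu z) w -> U (g (nu z) w) by exact: nU.
  suff : nbhs z (g (nu z) @^-1` U) by [].
  by near=> w; apply: (near nU w) => //; near: w; exact: nuP.
- move=> z; have [[_ +] _] := gB (nu z); apply.
  exact: nbhs_singleton.
- by have [_ +] := gB (nu z0).
Unshelve. all: by end_near. Qed.

End Covering.

(** Lifting is purely topological, so the disc may be traded for the plane; [h \o phi] is continuous
    everywhere because [phi] takes its values in the disc. *)
Lemma disc_lift (R : realType) (X Y : topologicalType) (f : X -> Y)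
    (h : R[i] -> Y) (a : R[i]) (x0 : X) :
  topological_covering f ->
  (forall z, unit_disc z -> {for z, continuous h}) ->
  unit_disc a -> f x0 = h a ->
  exists g : R[i] -> X, [/\ forall z, unit_disc z -> {for z, continuous g},
    forall z, unit_disc z -> f (g z) = h z & g a = x0].
Proof.
move=> cov ch ua fx0.
(* [phi] is a homeomorphism from the plane onto the disc, with inverse [psi]. *)
pose phi (z : R[i]) := z * (1 + `|z|)^-1.
pose psi (w : R[i]) := w * (1 - `|w|)^-1.
have pos (z : R[i]) : 0 < 1 + `|z| by rewrite ltr_wpDr.
have psub (z : R[i]) : unit_disc z -> 0 < 1 - `|z|.
  by rewrite unit_discE subr_gt0.
have uphi z : unit_disc (phi z).
  rewrite unit_discE normrM normfV (gtr0_norm (pos z)) ltr_pdivrMr// mul1r.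
  by rewrite ltr_pwDl.
have phiK z : unit_disc z -> phi (psi z) = z.
  move=> /psub uz; rewrite /phi normrM normfV (gtr0_norm uz) /psi.
  have -> : 1 + `|z| / (1 - `|z|) = (1 - `|z|)^-1.
    by rewrite -[X in X + _](divff (lt0r_neq0 uz)) -mulrDl subrK mul1r.
  by rewrite invrK -mulrA mulVf ?mulr1// gt_eqF.
have cphi : continuous phi.
  move=> z; apply: (@cvgM _ _ (nbhs z) _ id); first exact: cvg_id.
  apply: cvgV; first by rewrite gt_eqF.
  by apply: cvgD; [exact: cvg_cst|exact: norm_continuous].
have c1 : continuous (fun w : R[i] => 1 - `|w|).
  move=> w; exact (@cvgB _ _ _ (nbhs w) _ (cst (1 : R[i])) Num.norm _ _
    (cvg_cst _)
    (@norm_continuous _ _ w)).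
have cpsi z : unit_disc z -> {for z, continuous psi}.
  move=> uz; apply: (@cvgM _ _ (nbhs z) _ id); first exact: cvg_id.
  apply: cvgV; first by rewrite gt_eqF// psub.
  exact: c1.
have cF : continuous (h \o phi).
  by move=> z; apply: continuous_comp; [exact: cphi|exact: ch].
have [|g [cg fg ga]] := plane_lift cov cF (z0 := psi a) (x0 := x0).
  by rewrite /= phiK.
exists (g \o psi); split=> //.
  by move=> z uz; apply: continuous_comp; [exact: cpsi|exact: cg].
by move=> z uz; rewrite /= fg /= phiK.
Qed.

Lemma unit_disc_nbhs (R : realType) (z : R[i]) :
  unit_disc z -> nbhs z (@unit_disc R).
Proof.
move=> uz; have -> : @unit_disc R = ball (0 : R[i]) 1.
  by apply/seteqP; split => w; rewrite unit_discE -ball_normE /= sub0r normrN.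
apply: open_nbhs_nbhs; split; first exact: ball_open.
by rewrite -ball_normE /= sub0r normrN -unit_discE.
Qed.

(** Discs are lifted one after the other, each from the endpoint of the previous lift. The marked
    points [a] and [b] are kept, hence so is the length. *)
Lemma linked_lift (R : realType) (m n : nat) (X : complexManifoldType R m)
    (Y : complexManifoldType R n) (f : X -> Y) :
  topological_covering f -> locally_biholomorphic f ->
  forall x y L, linked (f x) y L -> exists2 x', f x' = y & linked x x' L.
Proof.
move=> cov bih x y L; elim=> [|a b h {}L ua ub hh _ [x' fx' xx']].
  by exists x => //; exact: linked_nil.
have [g [cg fg ga]] := disc_lift cov (fun z uz => (hh z uz).1) ua fx'.
exists (g b); first exact: fg.
apply: linked_step => //; last by rewrite ga.
move=> z uz; have [U [V [s [oU oV Uz [hom _ hs]]]]] := bih (g z).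
have [hUV _ _ _] := hom.
(* Near [z] the continuous lift is the local holomorphic inverse [s] of the covering applied to [h],
   hence holomorphic. *)
apply: (@near_eq_holomorphic_at _ _ _ (s \o h)).
  have nU : \forall w \near z, U (g w) by apply: (cg _ uz);
    exact: open_nbhs_nbhs.
  apply: filterS2 (unit_disc_nbhs uz) nU => w uw Uw.
  by rewrite /= -fg//; case: (hUV _ Uw).
apply: (holomorphic_at_comp hs _ (hh _ uz)).
by rewrite -fg//; case: (hUV _ Uz).
Qed.

(** * Vanishing of the pseudodistance *)

Section Closed.
Variables (R : realType) (n : nat) (Z : complexManifoldType R n).

Lemma poincare_dist0 (t : R) : 0 <= t ->
  poincare_dist 0 t%:C = ln ((1 + t) / (1 - t)).
Proof.
move=> t0; rewrite /poincare_dist mul0r subr0 divr1 sub0r.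
suff -> : Normc.normc (- t%:C) = t by [].
by apply: complexI; rewrite -normr_normc normrN ger0_norm// ler0c.
Qed.

Lemma near_linked (p : Z) (e : R) : 0 < e ->
  \forall q \near p, exists2 L, linked p q L & L <= e.
Proof.
move=> e0; have [phi aphi domp] := atlas_cover p.
have [hom1 hom2 _ _] := chart_homeo phi; have [imgp pK] := hom1 _ domp.
set c := chart_coord phi p in imgp pK.
have : nbhs c (chart_img phi).
  by apply: open_nbhs_nbhs; split => //; exact: chart_img_open.
move=> /nbhs_normP[r r0 rimg].
(* The disc [z |-> c + z v] in the chart takes [0] to [p] and [t] to [q], where
   [t] solves [(1 + t) / (1 - t) = 1 + e]. *)
pose t := e / (2 + e).
have t0 : 0 < t by rewrite divr_gt0// addr_gt0.
have t1 : t < 1 by rewrite ltr_pdivrMr ?addr_gt0// mul1r; lra.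
have tc0 : 0 < t%:C :> R[i] by rewrite ltcR.
have tr0 : 0 < t%:C * r by rewrite mulr_gt0.
have cphi : {for p, continuous (chart_coord phi)}.
  exact (homeomorphic_via_continuous (chart_homeo phi) (@chart_dom_open _ _ _
    phi) domp).
(* This bound gives [v] norm less than [r], which keeps the whole affine disc inside the chart. *)
have nq : \forall q \near p, `|c - chart_coord phi q| < t%:C * r.
  by move/(cvgrPdist_lt (F := nbhs p)): cphi => /(_ _ tr0).
have nd : \forall q \near p, chart_dom phi q.
  by apply: open_nbhs_nbhs; split => //; exact: chart_dom_open.
apply: filterS2 nq nd => q cq dq.
have [imgq qK] := hom1 _ dq.
set v := t%:C^-1 *: (chart_coord phi q - c).
have vr : `|v| < r.
  rewrite normrZ normfV (gtr0_norm tc0) mulrC ltr_pdivrMr// mulrC.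
  by rewrite distrC.
pose aff (z : R[i]) := c + z *: v.
pose f := chart_param phi \o aff.
have fp : f 0 = p by rewrite /f /aff /= scale0r addr0.
have fq : f t%:C = q.
  by rewrite /f /aff /= /v scalerA divff ?gt_eqF// scale1r addrC subrK.
have hf : holomorphic_disc f.
  move=> z uz; apply: (holomorphic_at_chart (f := aff)) => //.
  apply: rimg; rewrite /ball_ /= /aff opprD addNKr normrN normrZ.
  apply: le_lt_trans vr; rewrite ler_piMl//.
  by apply: ltW; rewrite -unit_discE.
exists (0 + poincare_dist 0 t%:C).
  rewrite -[X in linked _ X]fq; apply: linked_step => //.
  - by rewrite unit_discE normr0 ltr01.
  - by rewrite unit_discE gtr0_norm// ltcR.
  - by rewrite fp; exact: linked_nil.
rewrite add0r poincare_dist0; last exact: ltW.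
have -> : (1 + t) / (1 - t) = 1 + e.
  by rewrite /t; field; lra.
by apply: le_ln1Dx; lra.
Qed.

(** Arbitrarily short chains join a point of the closure to points at distance 0 from [p]. *)
Lemma closed_kobayashi_eq0 (p : Z) : closed [set q | kobayashi p q = 0%E].
Proof.
move=> q clq; apply/kobayashi_eq0P => e e0.
have e20 : 0 < e / 2 by lra.
have [q' [/kobayashi_eq0P pq' [L qq' Le]]] := clq _ (near_linked q e20).
have [L' pq'' Le'] := pq' _ e20.
exists (L' + L); last by lra.
by apply: linked_trans pq'' _; exact: linked_sym.
Qed.

End Closed.

(** Pigeonhole principle: a member of a finite list that works for arbitrarily small [e] works for
    every [e]. *)
Lemma seq_zero_infimum (R : realType) (T : eqType) (s : seq T) (P : T -> R ->
  Prop) :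
  (forall e, 0 < e -> exists x L, [/\ x \in s, P x L & L < e]) ->
  exists2 x, x \in s & forall e, 0 < e -> exists2 L, P x L & L < e.
Proof.
elim: s => [|x s IH] H; first by have [x [L []]] := H 1 ltr01.
have [?|] := pselect (forall e, 0 < e -> exists2 L, P x L & L < e).
  by exists x => //; rewrite mem_head.
move=> /existsNP[e1 /not_implyP[e10 nP]].
have [e e0|y ys Py] := IH; last by exists y => //; rewrite inE ys orbT.
(* The head [x] fails at [e1], so below the minimum the member found lies in the tail. *)
have [|y [L [+ Py Le]]] := H (Num.min e e1); first by rewrite lt_min e0.
move: Le; rewrite lt_min => /andP[Le Le1]; rewrite inE => /predU1P[yx|ys].
  by case: nP; exists L => //; rewrite -yx.
by exists y, L.
Qed.

Theorem proposition7p1 (R : realType) (m n : nat)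
    (X : complexManifoldType R m) (Y : complexManifoldType R n)
    (hX : connected_manifold X) (hY : connected_manifold Y)
    (pi : X -> Y) (hpi : finite_unramified_covering pi) :
  kobayashi_vanishes X <-> kobayashi_vanishes Y.
Proof.
case: hpi => hol cov bih fin; have [_ surj _] := cov.
split=> van.
  move=> y y'; have [x _ <-] : range pi y by rewrite surj.
  have [x' _ <-] : range pi y' by rewrite surj.
  apply/kobayashi_eq0P => e e0.
  have /kobayashi_eq0P/(_ _ e0)[L xx' Le] := van x x'.
  by exists L => //; exact: linked_map.
(* Short chains from [pi x] to [y] lift to chains from [x] ending in the fiber of [y]; this fiber
   being finite, one endpoint serves for all lengths. *)
have meet x y : exists2 x', pi x' = y & kobayashi x x' = 0%E.
  have /finite_seqP[s sE] := fin y.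
  have [e e0|x' x's Px'] := @seq_zero_infimum R X s (linked x).
    have /kobayashi_eq0P/(_ _ e0)[L xy Le] := van (pi x) y.
    have [x' fx' xx'] := linked_lift cov bih xy.
    exists x', L; split=> //.
    by have : [set` s] x' by rewrite -sE.
  exists x'; last exact/kobayashi_eq0P.
  by have : (pi @^-1` [set y]) x' by rewrite sE.
move=> p q; have [_ conX] := hX.
suff : [set q | kobayashi p q = 0%E] = [set: X].
  by move=> /seteqP[_]; exact.
have clA := @closed_kobayashi_eq0 _ _ X p.
have Ap : kobayashi p p = 0%E.
  by apply/kobayashi_eq0P => e e0; exists 0 => //; exact: linked_nil.
apply: conX; first by exists p.
  exists [set q | kobayashi p q = 0%E]; last by rewrite setTI.
  rewrite -[X in open X]setCK openC.
  (* Every class meets the fiber of [pi p], so the complement of the class of [p] is a finite union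
     of closed classes, and the class of [p] is open as well as closed. *)
  have -> : ~` [set q | kobayashi p q = 0%E] =
      \bigcup_(z in pi @^-1` [set pi p] `&` ~` [set q | kobayashi p q = 0%E])
        [set q | kobayashi z q = 0%E].
    apply/seteqP; split => x /=.
      move=> npx; have [z zp xz] := meet x (pi p).
      exists z; last exact: kobayashi_eq0_sym.
      split=> // pz; apply: npx; apply: kobayashi_eq0_trans pz _.
      exact: kobayashi_eq0_sym.
    move=> [z [_ npz] zx] px; apply: npz; apply: kobayashi_eq0_trans px _.
    exact: kobayashi_eq0_sym.
  apply: closed_bigcup; last by move=> z _; exact: closed_kobayashi_eq0.
  by apply: finite_setIl; exact: fin.
by exists [set q | kobayashi p q = 0%E]; rewrite ?setTI.
Qed.
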